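(* Let $m\ge 2$ and $n\ge 1$. Let ${\cal N}^*_m$ be the connected component of ${\cal D}^*_m$ containing $0^m$, and partition $V({\cal N}^*_m)$ into the classes $C=\{\rho^k(v),\rho^k(\overline{v}):0\le k\le m-1\}$ (these lie in $V({\cal N}^*_m)$). Index the classes $C_1,\dots,C_r$ with $C_1=\{0^m\}$, choose for each class $C_s$ an arbitrary representative $u_s\in C_s$ (so $u_1=0^m$), and let ${\cal N}^{**}_m$ be the directed multigraph on $\{C_1,\dots,C_r\}$ whose adjacency matrix $M$ has entries $M_{st}=\sum_{w\in C_t}{\cal T}^*_m(u_s,w)$, where ${\cal T}^*_m(u,w)$ is the number of arcs from $u$ to $w$ in ${\cal D}^*_m$. Then the number $f^{TnC}_m(n)$ of 2-factors of the thin grid cylinder $TnC_m(n)$ equals the $(1,1)$-entry of $M^n$.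
   Context: Alpha-letters (2-element subsets of the directions up, down, left, right): $a=\{\text{right},\text{down}\}$, $b=\{\text{up},\text{down}\}$, $c=\{\text{right},\text{up}\}$, $d=\{\text{left},\text{down}\}$, $e=\{\text{left},\text{right}\}$, $f=\{\text{left},\text{up}\}$. ${\cal D}_{ud}$: arc $(\alpha,\beta)$ iff ($\text{down}\in\alpha\iff\text{up}\in\beta$); ${\cal D}_{lr}$: arc $(\alpha,\beta)$ iff ($\text{right}\in\alpha\iff\text{left}\in\beta$). ${\cal D}_m$: vertices are the words $\alpha_1\cdots\alpha_m\in\{a,\dots,f\}^m$ with $(\alpha_i,\alpha_{i+1})$ an arc of ${\cal D}_{ud}$ for $1\le i\le m$ ($\alpha_{m+1}:=\alpha_1$); arc $v\to u$ iff $(v_i,u_i)$ is an arc of ${\cal D}_{lr}$ for all $i$. Outlet word $o(\alpha)\in\{0,1\}^m$: $o_j=1$ iff $\alpha_j\in\{a,c,e\}$; inlet word $i(\alpha)$: $i_j=1$ iff $\alpha_j\in\{d,e,f\}$. ${\cal D}^*_m$: vertex set $\{o(x):x\in V({\cal D}_m)\}$, number of arcs from $v$ to $w$ equal to $|\{y\in V({\cal D}_m): i(y)=v,\ o(y)=w\}|$. For a binary word $v=b_1\cdots b_m$: $\overline{v}=b_m\cdots b_1$, $\rho(v)=b_2\cdots b_mb_1$. Connected components are those of the underlying undirected multigraph. Thin grid cylinder $TnC_m(n)=C_m\times P_n$: multigraph (parallel edges allowed; simple for $m\ge3$) on $\{1,\dots,m\}\times\{1,\dots,n\}$, rows mod $m$,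 with vertical edges joining $(i,j)$ to $(i+1,j)$ for all $1\le i\le m$ and all $j$ (for $m=2$ these are two parallel edges), and horizontal edges joining $(i,j)$ to $(i,j+1)$ for $j\le n-1$. A 2-factor is a set of edges such that every vertex has degree exactly 2 in it. *)

(* Defs.v *)
From HB Require Import structures.
From mathcomp Require Import all_boot all_order all_algebra.

Set Implicit Arguments.
Unset Strict Implicit.
Unset Printing Implicit Defensive.

Inductive dir := Up | Down | Left | Right.

Definition nat_of_dir (x : dir) : nat :=
  match x with Up => 0 | Down => 1 | Left => 2 | Right => 3 end.
Definition dir_of_nat (k : nat) : option dir :=
  nth None [:: Some Up; Some Down; Some Left; Some Right] k.
Lemma nat_of_dirK : pcancel nat_of_dir dir_of_nat.
Proof. by case. Qed.
HB.instance Definition _ := Countable.copy dir (pcan_type nat_of_dirK).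
Lemma dir_enumP : Finite.axiom [:: Up; Down; Left; Right].
Proof. by case. Qed.
HB.instance Definition _ := isFinite.Build dir dir_enumP.

Inductive letter := La | Lb | Lc | Ld | Le | Lf.

Definition nat_of_letter (x : letter) : nat :=
  match x with La => 0 | Lb => 1 | Lc => 2 | Ld => 3 | Le => 4 | Lf => 5 end.
Definition letter_of_nat (k : nat) : option letter :=
  nth None [:: Some La; Some Lb; Some Lc; Some Ld; Some Le; Some Lf] k.
Lemma nat_of_letterK : pcancel nat_of_letter letter_of_nat.
Proof. by case. Qed.
HB.instance Definition _ := Countable.copy letter (pcan_type nat_of_letterK).
Lemma letter_enumP : Finite.axiom [:: La; Lb; Lc; Ld; Le; Lf].
Proof. by case. Qed.
HB.instance Definition _ := isFinite.Build letter letter_enumP.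

Definition dirs (x : letter) : {set dir} :=
  match x with
  | La => [set Right; Down]
  | Lb => [set Up; Down]
  | Lc => [set Right; Up]
  | Ld => [set Left; Down]
  | Le => [set Left; Right]
  | Lf => [set Left; Up]
  end.

Definition D_ud : rel letter := [rel x y | (Down \in dirs x) == (Up \in dirs y)].
Definition D_lr : rel letter := [rel x y | (Right \in dirs x) == (Left \in dirs y)].

(* [ordS] is the cyclic successor, which gives the convention
   alpha_{m+1} := alpha_1. *)
Definition D_vert (m : nat) : {set m.-tuple letter} :=
  [set x : m.-tuple letter | [forall i, D_ud (tnth x i) (tnth x (ordS i))]].
Definition D_arc (m : nat) : rel (m.-tuple letter) :=
  [rel v u | [&& v \in D_vert m, u \in D_vert m &
    [forall i, D_lr (tnth v i) (tnth u i)]]].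

Definition outlet (m : nat) (x : m.-tuple letter) : m.-tuple bool :=
  [tuple tnth x j \in [:: La; Lc; Le] | j < m].
Definition inlet (m : nat) (x : m.-tuple letter) : m.-tuple bool :=
  [tuple tnth x j \in [:: Ld; Le; Lf] | j < m].

Definition Dstar_vert (m : nat) : {set m.-tuple bool} :=
  [set outlet x | x in D_vert m].

(* The number of arcs from v to w; meaningful for v, w \in Dstar_vert m. *)
Definition Tstar (m : nat) (v w : m.-tuple bool) : nat :=
  #|[set y in D_vert m | (inlet y == v) && (outlet y == w)]|.

Definition Dstar_adj (m : nat) : rel (m.-tuple bool) :=
  [rel v w | [&& v \in Dstar_vert m, w \in Dstar_vert m &
    (0 < Tstar v w) || (0 < Tstar w v)]].

Definition zero_word (m : nat) : m.-tuple bool := [tuple of nseq m false].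

Definition Nstar_vert (m : nat) : {set m.-tuple bool} :=
  [set v in Dstar_vert m | connect (@Dstar_adj m) (zero_word m) v].

Definition rho (m : nat) (v : m.-tuple bool) : m.-tuple bool :=
  [tuple of rot 1 v].
Definition bar (m : nat) (v : m.-tuple bool) : m.-tuple bool :=
  [tuple of rev v].

Definition word_class (m : nat) (v : m.-tuple bool) : {set m.-tuple bool} :=
  [set iter k (@rho m) v | k : 'I_m] :|: [set iter k (@rho m) (bar v) | k : 'I_m].

Definition Nclasses (m : nat) : {set {set m.-tuple bool}} :=
  [set word_class v | v in Nstar_vert m].

Definition Nquo_mx (m r : nat) (C : 'I_r -> {set m.-tuple bool})
    (u : 'I_r -> m.-tuple bool) : 'M[nat]_r :=
  \matrix_(s, t) \sum_(w in C t) Tstar (u s) w.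

Record multigraph := MultiGraph {
  vertex : finType;
  edge : finType;
  ends : edge -> vertex * vertex }.

(* A loop would contribute 2. *)
Definition degree (G : multigraph) (F : {set edge G}) (v : vertex G) : nat :=
  \sum_(e in F) (((ends e).1 == v) + ((ends e).2 == v)).

Definition two_factor (G : multigraph) (F : {set edge G}) : bool :=
  [forall v, degree F v == 2].

Lemma right_column_proof (n : nat) (j : 'I_n.-1) : j.+1 < n.
Proof. by rewrite -ltn_predRL. Qed.
Definition left_column (n : nat) (j : 'I_n.-1) : 'I_n := widen_ord (leq_pred n) j.
Definition right_column (n : nat) (j : 'I_n.-1) : 'I_n :=
  Ordinal (right_column_proof j).

(* Edge [inl (i, j)] is the vertical edge from (i, j) to (i + 1, j) with rows
   mod m (so m = 2 gives two parallel edges), and [inr (i, j)] is the horizontal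
   edge from (i, j) to (i, j + 1). *)
Definition TnC (m n : nat) : multigraph :=
  @MultiGraph ('I_m * 'I_n)%type ('I_m * 'I_n + 'I_m * 'I_n.-1)%type
    (fun e => match e with
              | inl (i, j) => ((i, j), (ordS i, j))
              | inr (i, j) => ((i, left_column j), (i, right_column j))
              end).

Definition f_TnC (m n : nat) : nat := #|[set F : {set edge (TnC m n)} | two_factor F]|.

(* Main.v *)
(** Cutting the cylinder between consecutive columns, a 2-factor is determined by
    the words recording which horizontal edges cross each cut, together with, for
    each column, a set of vertical edges completing its two adjacent words to
    degree 2 everywhere.  Tstar counts exactly these completions, so 2-factors are
    closed walks of length n at 0^m in D*_m.  Such walks stay in the component of
    0^m, and Tstar is invariant under rotation and reversal, so the number of walks
    from v to 0^m depends only on the class of v: summing Tstar over classes gives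
    the same count. *)
Require Import Defs.
From HB Require Import structures.
From mathcomp Require Import all_boot all_order all_algebra.
From mathcomp Require Import zify.

Set Implicit Arguments.
Unset Strict Implicit.
Unset Printing Implicit Defensive.

(** * Rotation and reversal of cyclic words *)

Lemma rev_ordS (m : nat) (i : 'I_m) : rev_ord (ordS i) = ord_pred (rev_ord i).
Proof.
apply: val_inj => /=; have := ltn_ord i; move: (val i) => k hk.
have [->|ne] := eqVneq k.+1 m; first by rewrite modnn subnn add0n subn1 modn_small; lia.
rewrite modn_small; last by lia.
have -> : (m - k.+1 + m).-1 = m - k.+2 + m by lia.
by rewrite modnDr modn_small; lia.
Qed.

Lemma tnth_rho (m : nat) (v : m.-tuple bool) (i : 'I_m) :
  tnth (rho v) i = tnth v (ordS i).
Proof.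
have hi := ltn_ord i.
rewrite !(tnth_nth false) /= nth_cat size_drop size_tuple nth_drop add1n ltn_subRL add1n.
case: ltnP => h; first by rewrite modn_small.
have e : i.+1 = m by apply/eqP; rewrite eqn_leq hi h.
have -> : i - (m - 1) = 0 by lia.
by rewrite [in RHS]e modnn nth_take.
Qed.

Lemma tnth_bar (m : nat) (v : m.-tuple bool) (i : 'I_m) :
  tnth (bar v) i = tnth v (rev_ord i).
Proof.
by rewrite !(tnth_nth false) /= nth_rev ?size_tuple.
Qed.

Lemma barK (m : nat) : involutive (@bar m).
Proof. by move=> v; apply: val_inj; rewrite /= revK. Qed.

Lemma rho_inj (m : nat) : injective (@rho m).
Proof.
move=> v w /(congr1 val) /= h; apply: val_inj.
by apply: (can_inj (rotK 1)) h.
Qed.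

Lemma val_iter_rho (m k : nat) (v : m.-tuple bool) :
  k <= m -> val (iter k (@rho m) v) = rot k v.
Proof.
elim: k => [_|k IH hk]; first by rewrite rot0.
by rewrite iterS /= IH 1?ltnW // -rotS // size_tuple.
Qed.

Lemma iter_rho_period (m : nat) (v : m.-tuple bool) : iter m (@rho m) v = v.
Proof. by apply: val_inj; rewrite val_iter_rho // -[X in rot X _](size_tuple v) rot_size. Qed.

Lemma iter_rho_mod (m k : nat) (v : m.-tuple bool) :
  iter (k %% m) (@rho m) v = iter k (@rho m) v.
Proof.
rewrite [in RHS](divn_eq k m) addnC iterD; congr iter.
by elim: (k %/ m) => // q IH; rewrite mulSn iterD -IH iter_rho_period.
Qed.

(** The dihedral relation: reversal turns a rotation by [k] into its inverse, which is the rotation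
    by [m - k]. *)
Lemma bar_iter_rho (m k : nat) (v : m.-tuple bool) : k <= m ->
  bar (iter k (@rho m) v) = iter (m - k) (@rho m) (bar v).
Proof.
move=> hk; apply: val_inj.
by rewrite val_iter_rho ?leq_subr //= val_iter_rho // rev_rot /rotr size_rev size_tuple.
Qed.

(** * Word classes as dihedral orbits *)

Section WordClass.

Variable m : nat.
Hypothesis m_gt0 : 0 < m.
Implicit Types v w : m.-tuple bool.

Lemma iter_rho_word_class k v : iter k (@rho m) v \in word_class v.
Proof.
apply/setUP; left; apply/imsetP.
by exists (Ordinal (ltn_pmod k m_gt0)); rewrite //= iter_rho_mod.
Qed.

Lemma iter_rho_bar_word_class k v : iter k (@rho m) (bar v) \in word_class v.
Proof.
apply/setUP; right; apply/imsetP.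
by exists (Ordinal (ltn_pmod k m_gt0)); rewrite //= iter_rho_mod.
Qed.

Lemma word_class_refl v : v \in word_class v.
Proof. exact: iter_rho_word_class 0 v. Qed.

(** Every member of a class arises from [v] by at most one reversal followed by rotations. This is
    how invariance under the two generators is later spread over whole classes. *)
Lemma word_class_ind (P : m.-tuple bool -> Prop) v w :
  (forall x, P x -> P (rho x)) -> (forall x, P x -> P (bar x)) ->
  P v -> w \in word_class v -> P w.
Proof.
move=> Prho Pbar Pv.
have Piter k x : P x -> P (iter k (@rho m) x).
  by move=> Px; elim: k => //= k; exact: Prho.
by case/setUP => /imsetP[k _ ->]; apply: Piter; last exact: Pbar.
Qed.

Lemma rho_word_class v w : w \in word_class v -> rho w \in word_class v.
Proof.
case/setUP => /imsetP[k _ ->]; first exact: (iter_rho_word_class k.+1 v).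
exact: (iter_rho_bar_word_class k.+1 v).
Qed.

Lemma bar_word_class v w : w \in word_class v -> bar w \in word_class v.
Proof.
case/setUP => /imsetP[k _ ->]; rewrite bar_iter_rho 1?ltnW ?ltn_ord //.
  exact: iter_rho_bar_word_class.
by rewrite barK; exact: iter_rho_word_class.
Qed.

Lemma word_class_trans v w x :
  w \in word_class v -> x \in word_class w -> x \in word_class v.
Proof.
move=> wv; apply: (@word_class_ind (fun y => y \in word_class v)) wv => y.
  exact: rho_word_class.
exact: bar_word_class.
Qed.

Lemma word_class_sym v w : w \in word_class v -> v \in word_class w.
Proof.
have back (k : 'I_m) x : iter (m - k) (@rho m) (iter k (@rho m) x) = x.
  by rewrite -iterD subnK ?iter_rho_period // ltnW.
case/setUP => /imsetP[k _ ->].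
  by rewrite -{1}(back k v); exact: iter_rho_word_class.
rewrite -{1}(barK v) -{1}(back k (bar v)).
by apply: bar_word_class; exact: iter_rho_word_class.
Qed.

Lemma word_class_eq v w : w \in word_class v -> word_class w = word_class v.
Proof.
move=> wv; apply/setP => x; apply/idP/idP; first exact: word_class_trans.
exact/word_class_trans/word_class_sym.
Qed.

End WordClass.

Lemma rho_zero_word (m : nat) : rho (zero_word m) = zero_word m.
Proof. by apply: eq_from_tnth => i; rewrite tnth_rho !tnth_nseq. Qed.

Lemma bar_zero_word (m : nat) : bar (zero_word m) = zero_word m.
Proof. by apply: eq_from_tnth => i; rewrite tnth_bar !tnth_nseq. Qed.

Lemma word_class_zero_word (m : nat) :
  0 < m -> word_class (zero_word m) = [set zero_word m].
Proof.
move=> m_gt0; apply/setP => w; rewrite in_set1; apply/idP/eqP => [|->].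
  apply: (@word_class_ind m (fun w => w = zero_word m)) => // x ->.
    exact: rho_zero_word.
  exact: bar_zero_word.
exact: word_class_refl.
Qed.

(** * Letters as degree-two vertices, and arcs as sets of vertical edges *)

Lemma letterP (x : letter) :
  [/\ (Left \in dirs x) = (x \in [:: Ld; Le; Lf]),
      (Right \in dirs x) = (x \in [:: La; Lc; Le])
    & (Left \in dirs x) + (Right \in dirs x) + (Down \in dirs x) + (Up \in dirs x) = 2].
Proof. by case: x; rewrite /= !inE. Qed.

(** The direction up is not an argument, since the total of two determines it. Triples that cannot
    be completed to two directions get an arbitrary letter. *)
Definition letter_of_dirs (l r d : bool) : letter :=
  if l then (if r then Le else if d then Ld else Lf)
  else if r then (if d then La else Lc) else Lb.

Lemma dirs_letter_of_dirs (l r d u : bool) : l + r + d + u == 2 ->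
  let x := letter_of_dirs l r d in
  [/\ (Left \in dirs x) = l, (Right \in dirs x) = r,
      (Down \in dirs x) = d & (Up \in dirs x) = u].
Proof. by case: l r d u => [] [] [] []; rewrite //= !inE. Qed.

Lemma letter_of_dirsK (x : letter) :
  letter_of_dirs (Left \in dirs x) (Right \in dirs x) (Down \in dirs x) = x.
Proof. by case: x; rewrite /= !inE. Qed.

(* A word of [D_vert] is determined by its inlet [p], its outlet [q] and the set
   [v] of vertical edges below its letters; [p], [q] and [v] are compatible iff
   every letter gets exactly two directions. *)
Definition columns (m : nat) (p q : m.-tuple bool) : {set m.-tuple bool} :=
  [set v : m.-tuple bool | [forall i,
     tnth p i + tnth q i + tnth v i + tnth v (ord_pred i) == 2]].

Definition word_of_column (m : nat) (p q v : m.-tuple bool) : m.-tuple letter :=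
  [tuple letter_of_dirs (tnth p i) (tnth q i) (tnth v i) | i < m].

Definition downs (m : nat) (y : m.-tuple letter) : m.-tuple bool :=
  [tuple Down \in dirs (tnth y i) | i < m].

(** [word_of_column] and [downs] are mutually inverse here: the cyclic condition [D_ud] says that
    the up-bit of a letter is the down-bit of its predecessor, so the down-bits alone carry all the
    vertical information. *)
Lemma Tstar_columns (m : nat) (p q : m.-tuple bool) : Tstar p q = #|columns p q|.
Proof.
have fact v : v \in columns p q -> forall i,
  let x := tnth (word_of_column p q v) i in
  [/\ (Left \in dirs x) = tnth p i, (Right \in dirs x) = tnth q i,
      (Down \in dirs x) = tnth v i & (Up \in dirs x) = tnth v (ord_pred i)].
  rewrite inE => /forallP hv i /=; rewrite tnth_mktuple.
  exact: dirs_letter_of_dirs.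
have inj : {in columns p q &, injective (word_of_column p q)}.
  move=> v w /fact hv /fact hw e; apply: eq_from_tnth => i.
  by have [_ _ <- _] := hv i; have [_ _ <- _] := hw i; rewrite e.
rewrite /Tstar -(card_in_imset inj); congr #|pred_of_set _|; apply/setP => y.
rewrite !inE; apply/idP/imsetP => [/and3P[/forallP ud /eqP <- /eqP <-]|[v hv ->]].
  have up i : (Up \in dirs (tnth y i)) = tnth (downs y) (ord_pred i).
    by rewrite tnth_mktuple; have := ud (ord_pred i); rewrite /D_ud /= ord_predK => /eqP.
  exists (downs y).
    rewrite inE; apply/forallP => i; rewrite -up !tnth_mktuple.
    by have [<- <- ->] := letterP (tnth y i).
  apply: eq_from_tnth => i; rewrite !tnth_mktuple.
  by have [<- <- _] := letterP (tnth y i); rewrite letter_of_dirsK.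
have {}fact := fact v hv; apply/and3P; split.
- apply/forallP => i; rewrite /D_ud /=.
  by have [_ _ -> _] := fact i; have [_ _ _ ->] := fact (ordS i); rewrite ordSK.
- apply/eqP/eq_from_tnth => i; rewrite tnth_mktuple.
  by have [<- _ _] := letterP (tnth (word_of_column p q v) i); case: (fact i).
- apply/eqP/eq_from_tnth => i; rewrite tnth_mktuple.
  by have [_ <- _] := letterP (tnth (word_of_column p q v) i); case: (fact i).
Qed.

(** * Dihedral symmetry of the arc counts *)

Lemma Tstar_rho (m : nat) (p q : m.-tuple bool) : Tstar (rho p) (rho q) = Tstar p q.
Proof.
rewrite !Tstar_columns -(card_preimset _ (@rho_inj m)).
apply: eq_card => v; rewrite !inE; apply/forallP/forallP => h i.
  by have := h (ord_pred i); rewrite !tnth_rho !ord_predK.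
by rewrite !tnth_rho ord_predK; have := h (ordS i); rewrite ordSK.
Qed.

(** Flipping the column exchanges the edge below a vertex with the edge above it. Vertical edges are
    indexed by their upper end, so they are transported by [rho (bar v)] and not by [bar v]. *)
Lemma Tstar_bar (m : nat) (p q : m.-tuple bool) : Tstar (bar p) (bar q) = Tstar p q.
Proof.
have inj : injective (fun v : m.-tuple bool => rho (bar v)).
  by move=> v w /rho_inj /(can_inj (@barK m)).
rewrite !Tstar_columns -(card_preimset _ inj).
apply: eq_card => v; rewrite !inE; apply/forallP/forallP => h i.
  have := h (rev_ord i); rewrite !(tnth_rho, tnth_bar) ord_predK !rev_ordS !rev_ordK.
  by rewrite -!addnA [X in _ + (_ + X)]addnC.
rewrite !(tnth_rho, tnth_bar) ord_predK !rev_ordS.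
by have := h (rev_ord i); rewrite -!addnA [X in _ + (_ + X)]addnC.
Qed.

(** * The component of the zero word and its classes *)

Lemma Dstar_vertP (m : nat) (w : m.-tuple bool) :
  reflect (exists v, 0 < Tstar v w) (w \in Dstar_vert m).
Proof.
apply: (iffP imsetP) => [[y hy ->]|[v /card_gt0P[y]]].
  by exists (inlet y); apply/card_gt0P; exists y; rewrite inE hy !eqxx.
by rewrite inE => /and3P[hy _ /eqP <-]; exists y.
Qed.

Lemma zero_word_Nstar (m : nat) : zero_word m \in Nstar_vert m.
Proof.
(* The word b...b is the column filled by its vertical cycle, with no horizontal edge. *)
rewrite inE connect0 andbT; apply/imsetP; exists [tuple of nseq m Lb].
  by rewrite inE; apply/forallP => i; rewrite /D_ud /= !tnth_nseq /= !inE.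
by apply: eq_from_tnth => i; rewrite tnth_mktuple !tnth_nseq.
Qed.

(** Such an [f] carries a path starting at the zero word to another one; the induction peels off the
    last arc of the path. *)
Lemma Nstar_vert_stable (m : nat) (f : m.-tuple bool -> m.-tuple bool) :
  (forall v w, Tstar (f v) (f w) = Tstar v w) -> f (zero_word m) = zero_word m ->
  forall v, v \in Nstar_vert m -> f v \in Nstar_vert m.
Proof.
move=> fT f0 v.
have fD w : w \in Dstar_vert m -> f w \in Dstar_vert m.
  by case/Dstar_vertP => x hx; apply/Dstar_vertP; exists (f x); rewrite fT.
rewrite !inE => /andP[/fD-> /connectP[s]] /=.
elim/last_ind: s v => [|s x IH] v; first by move=> _ -> /=; rewrite f0 connect0.
rewrite rcons_path last_rcons => /andP[hs /and3P[h1 h2 h3]] ->.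
apply: connect_trans (IH _ hs erefl) (connect1 _).
by apply/and3P; split; rewrite ?fD // !fT.
Qed.

Lemma Nstar_vert_closed (m : nat) (v w : m.-tuple bool) :
  v \in Nstar_vert m -> 0 < Tstar v w -> w \in Nstar_vert m.
Proof.
rewrite !inE => /andP[hv cv] h.
have hw : w \in Dstar_vert m by apply/Dstar_vertP; exists v.
rewrite hw; apply: connect_trans cv (connect1 _).
by apply/and3P; split=> //; rewrite h.
Qed.

Lemma word_class_sub_Nstar (m : nat) (v : m.-tuple bool) :
  v \in Nstar_vert m -> word_class v \subset Nstar_vert m.
Proof.
move=> hv; apply/subsetP => w.
apply: (@word_class_ind m (fun x => x \in Nstar_vert m)) hv => x.
  exact: (Nstar_vert_stable (@Tstar_rho m) (rho_zero_word m)).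
exact: (Nstar_vert_stable (@Tstar_bar m) (bar_zero_word m)).
Qed.

Lemma Nclasses_partition (m : nat) : 0 < m -> partition (Nclasses m) (Nstar_vert m).
Proof.
move=> m_gt0; apply/and3P; split.
- apply/eqP/setP => w; apply/bigcupP/idP => [[A /imsetP[v hv ->]]|hw].
    exact/subsetP/word_class_sub_Nstar.
  by exists (word_class w); [apply/imsetP; exists w | exact: word_class_refl].
- apply/trivIsetP => _ _ /imsetP[v _ ->] /imsetP[w _ ->]; apply: contraR.
  case/pred0Pn => x /andP[/= xv xw].
  by rewrite -(word_class_eq m_gt0 xv) -(word_class_eq m_gt0 xw).
- apply/imsetP => [[v _ e]].
  by have := word_class_refl m_gt0 v; rewrite -e inE.
Qed.

(** * Counting walks with multiplicity *)

Section Walks.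

Variables (S : finType) (T : S -> S -> nat) (z : S).

(** Walks of length [n] from [v] to the fixed target [z], where [T] gives the numbers of parallel
    arcs; the recursion is on the first arc. *)
Fixpoint nwalks (n : nat) (v : S) : nat :=
  if n is n'.+1 then \sum_w T v w * nwalks n' w else v == z.

Lemma nwalks_morph (f : S -> S) : injective f ->
  (forall v w, T (f v) (f w) = T v w) -> f z = z ->
  forall n v, nwalks n (f v) = nwalks n v.
Proof.
move=> f_inj fT fz; elim=> [|n IH] v /=; first by rewrite -{1}fz (inj_eq f_inj).
rewrite (reindex_inj f_inj) /=; apply: eq_bigr => w _.
by rewrite fT IH.
Qed.

Lemma sum_tuple_cons (k : nat) (F : k.+1.-tuple S -> nat) :
  \sum_h F h = \sum_x \sum_(h : k.-tuple S) F [tuple of x :: h].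
Proof.
rewrite pair_big /= (reindex (fun p : S * k.-tuple S => [tuple of p.1 :: p.2])) //=.
exists (fun h => (thead h, [tuple of behead h])) => [[x h] _|h _] /=.
  by congr pair; apply: val_inj.
by rewrite -tuple_eta.
Qed.

(** Unfolds the recursion into a sum over the [k] interior vertices [h] of a walk with [k.+1]
    arcs. *)
Lemma nwalks_sum_tuple (k : nat) (v : S) :
  nwalks k.+1 v =
  \sum_(h : k.-tuple S) \prod_(j < k.+1)
     T (nth z (v :: rcons h z) j) (nth z (v :: rcons h z) j.+1).
Proof.
elim: k v => [|k IH] v.
  rewrite (big_pred1 [tuple]) => [|h]; last by rewrite [h]tuple0 /= eq_refl.
  rewrite big_ord_recl big_ord0 /= (bigD1 z) //= eqxx big1 ?addn0 // => w /negPf->.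
  by rewrite muln0.
rewrite sum_tuple_cons [LHS]/=; apply: eq_bigr => x _.
rewrite -[\sum_w _]/(nwalks k.+1 x) IH big_distrr; apply: eq_bigr => h _.
by rewrite [in RHS]big_ord_recl.
Qed.

End Walks.

Arguments nwalks {S} T z n v.

Lemma sum_indicator (I : finType) (P : pred I) (a : I) :
  \sum_(i | P i) (i == a) = P a.
Proof.
rewrite big_mkcond (bigD1 a) //= eqxx big1 => [|i /negPf->]; first by case: (P a).
by case: (P i).
Qed.

(** * From 2-factors to closed walks at the zero word *)

Section TwoFactors.

Variables (m k : nat).

Local Notation word := (m.-tuple bool).

(** The first component holds one word for each of the [k] cuts between columns, the second one word
    of vertical edges for each of the [k.+1] columns. *)
Definition edge_set (x : k.-tuple word * {ffun 'I_k.+1 -> word}) :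
    {set edge (TnC m k.+1)} :=
  [set e : edge (TnC m k.+1) | match e with
     | inl (i, j) => tnth (x.2 j) i
     | inr (i, j) => tnth (tnth x.1 j) i
     end].

Lemma edge_set_bij : bijective edge_set.
Proof.
exists (fun F : {set edge (TnC m k.+1)} =>
    ([tuple [tuple inr (i, j) \in F | i < m] | j < k],
     [ffun j => [tuple inl (i, j) \in F | i < m]])) => [[h V]|F].
  congr pair; last apply/ffunP => j; last rewrite ffunE; last apply: eq_from_tnth => i.
    apply: eq_from_tnth => j; apply: eq_from_tnth => i.
    by rewrite !tnth_mktuple inE.
  by rewrite tnth_mktuple inE.
by apply/setP => -[[i j]|[i j]]; rewrite inE /= ?ffunE !tnth_mktuple.
Qed.

(** Column [j] lies between the entries [j] and [j.+1] of [s]. The zero words at both ends of [s]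
    stand for the missing horizontal edges outside the grid. *)
Lemma degree_edge_set (h : k.-tuple word) (V : {ffun 'I_k.+1 -> word}) (i : 'I_m) (j : 'I_k.+1) :
  let s := zero_word m :: rcons h (zero_word m) in
  degree (edge_set (h, V)) ((i, j) : vertex (TnC m k.+1)) =
  tnth (nth (zero_word m) s j) i + tnth (nth (zero_word m) s j.+1) i +
  tnth (V j) i + tnth (V j) (ord_pred i).
Proof.
move=> s; rewrite /degree big_sumType /= !big_split /= -[RHS]addnA [RHS]addnC.
(* The four goals are the vertical edge below, the vertical edge above, the horizontal edge on the
   left and the one on the right. *)
congr (_ + _); last rewrite addnC; congr (_ + _).
- rewrite (eq_bigr (fun p => p == (i, j) : nat)) => [|[] //].
  by rewrite sum_indicator inE.
- rewrite (eq_bigr (fun p => p == (ord_pred i, j) : nat)) => [|[a b] _].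
    by rewrite sum_indicator inE.
  rewrite /= !xpair_eqE; congr (nat_of_bool (_ && _)).
  by apply/eqP/eqP => [<-|->]; rewrite ?ord_predK ?ordSK.
- rewrite /s; case: j => [[|j] hj] /=.
    rewrite tnth_nseq; apply: big1 => -[a b] _.
    by rewrite /= xpair_eqE -(inj_eq val_inj) andbF.
  rewrite nth_rcons size_tuple -ltnS hj.
  rewrite (eq_bigr (fun p => p == (i, Ordinal (hj : j < k)) : nat)) => [|[a b] _].
    by rewrite sum_indicator inE (tnth_nth (zero_word m)).
  by rewrite /= !xpair_eqE.
- rewrite /s /= nth_rcons size_tuple; case: ltnP => hj.
    rewrite (eq_bigr (fun p => p == (i, Ordinal hj) : nat)) => [|[a b] _].
      by rewrite sum_indicator inE (tnth_nth (zero_word m)).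
    by rewrite /= !xpair_eqE.
  rewrite if_same tnth_nseq; apply: big1 => -[a b] _.
  rewrite /= xpair_eqE -[_ == j](inj_eq val_inj) /= andbC.
  by case: eqP => // e; move: hj; rewrite -e leqNgt ltn_ord.
Qed.

(** Once the horizontal edges are fixed, the degree conditions separate column by column, so the
    admissible [V] form a product of sets. *)
Lemma two_factor_edge_set (h : k.-tuple word) (V : {ffun 'I_k.+1 -> word}) :
  let s := zero_word m :: rcons h (zero_word m) in
  two_factor (edge_set (h, V)) =
  (V \in family (fun j : 'I_k.+1 =>
     columns (nth (zero_word m) s j) (nth (zero_word m) s j.+1))).
Proof.
move=> s; apply/forallP/familyP => [hF j|hV [i j]].
  by rewrite inE; apply/forallP => i; have := hF (i, j); rewrite degree_edge_set.
by rewrite degree_edge_set; have := hV j; rewrite inE => /forallP.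
Qed.

Lemma f_TnC_nwalks : f_TnC m k.+1 = nwalks (@Tstar m) (zero_word m) k.+1 (zero_word m).
Proof.
rewrite nwalks_sum_tuple /f_TnC -sum1dep_card (reindex edge_set) /=; last first.
  exact: onW_bij edge_set_bij.
rewrite -(pair_big_dep predT (fun h V => two_factor (edge_set (h, V))) (fun _ _ => 1)) /=.
apply: eq_bigr => h _; under eq_bigl => V do rewrite two_factor_edge_set.
(* The product set has as cardinality the product of the numbers of completions of the columns. *)
rewrite sum1_card card_family foldrE big_map big_enum /=.
by apply: eq_bigr => j _; rewrite Tstar_columns.
Qed.

End TwoFactors.

(** * Passing to the quotient by the classes *)

Section Lumping.

Variables (m r : nat) (C : 'I_r.+1 -> {set m.-tuple bool}) (u : 'I_r.+1 -> m.-tuple bool).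
Hypotheses (m_gt0 : 0 < m) (C_inj : injective C)
  (C_classes : [set C s | s : 'I_r.+1] = Nclasses m)
  (C0 : C ord0 = [set zero_word m]) (uC : forall s, u s \in C s).

Lemma class_word_class s w : w \in C s -> C s = word_class w.
Proof.
have : C s \in Nclasses m by rewrite -C_classes imset_f.
by case/imsetP => v _ -> /(word_class_eq m_gt0)->.
Qed.

Lemma nwalks_word_class n v w : w \in word_class v ->
  nwalks (@Tstar m) (zero_word m) n w = nwalks (@Tstar m) (zero_word m) n v.
Proof.
apply: (@word_class_ind m (fun w => nwalks _ _ n w = nwalks _ _ n v)) => // x <-.
  by apply: nwalks_morph; [exact: rho_inj | exact: Tstar_rho | exact: rho_zero_word].
apply: nwalks_morph; [exact: can_inj (@barK m) | exact: Tstar_bar | exact: bar_zero_word].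
Qed.

(** Stated for every row [s], because the first arc of a walk may lead into any class. *)
Lemma Nquo_mx_exp n s :
  (Nquo_mx C u ^+ n)%R s ord0 = nwalks (@Tstar m) (zero_word m) n (u s).
Proof.
elim: n s => [|n IH] s.
  rewrite GRing.expr0 mxE /=.
  suff -> : (s == ord0) = (u s == zero_word m) by case: eqP.
  apply/eqP/eqP => [->|us0]; first by have := uC ord0; rewrite C0 inE => /eqP.
  by apply: C_inj; rewrite C0 (class_word_class (uC s)) us0 word_class_zero_word.
rewrite GRing.exprS mxE /=.
have us : u s \in Nstar_vert m.
  have /and3P[/eqP <- _ _] := Nclasses_partition m_gt0.
  by apply/bigcupP; exists (C s); rewrite // -C_classes imset_f.
(* Words outside the component contribute nothing: no arc leads to them from [u s]. The remaining
   sum is then split along the classes. *)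
rewrite (bigID (mem (Nstar_vert m))) /= [X in _ = _ + X]big1 ?addn0; last first.
  move=> w; apply: contraNeq; rewrite -lt0n muln_gt0 => /andP[h _].
  exact: Nstar_vert_closed h.
have /and3P[/eqP <- tI _] := Nclasses_partition m_gt0.
rewrite big_trivIset //= -C_classes big_imset /=; last by move=> x y _ _; exact: C_inj.
apply: eq_bigr => t _; rewrite mxE IH.
(* Exposes the semiring product as the product of [nat], so that it distributes over the class; the
   walk count is constant there. *)
rewrite -[LHS]/((\sum_(w in C t) Tstar (u s) w) * _)%N big_distrl; apply: eq_bigr => w wt /=.
congr (_ * _); apply: nwalks_word_class.
by rewrite -(class_word_class wt).
Qed.

End Lumping.

Theorem theorem7 (m n : nat) (hm : 2 <= m) (hn : 1 <= n) :
  [/\ partition (Nclasses m) (Nstar_vert m),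
      [set zero_word m] \in Nclasses m
    & forall (r : nat) (C : 'I_r.+1 -> {set m.-tuple bool})
        (u : 'I_r.+1 -> m.-tuple bool),
        injective C ->
        [set C s | s : 'I_r.+1] = Nclasses m ->
        C ord0 = [set zero_word m] ->
        (forall s, u s \in C s) ->
        f_TnC m n = (Nquo_mx C u ^+ n)%R ord0 ord0].
Proof.
have m_gt0 : 0 < m by exact: ltnW.
split; first exact: Nclasses_partition.
  by rewrite -word_class_zero_word //; apply: imset_f; exact: zero_word_Nstar.
move=> r C u C_inj C_classes C0 uC.
rewrite (Nquo_mx_exp m_gt0 C_inj C_classes C0 uC).
have -> : u ord0 = zero_word m by have := uC ord0; rewrite C0 inE => /eqP.
by case: n hn => // k _; exact: f_TnC_nwalks.
Qed.
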